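(* Let $(\Omega,\mathcal{F})$ be a standard Borel space, and let $\mathcal{G}$ be a sub-$\sigma$-algebra of $\mathcal{F}$ that can be written as $\mathcal{G}=\bigcap_{n\in\mathbb{N}}\mathcal{G}_n$ for some countably-generated sub-$\sigma$-algebras $\mathcal{G}_1\supseteq\mathcal{G}_2\supseteq\cdots$ of $\mathcal{F}$. Then $\mathcal{G}$ is strongly dualizable.
   Context: For $\mathcal{G}\subseteq\mathcal{F}$, define the equivalence relation $\mathcal{G}^{\ast}:=\{(\omega,\omega')\in\Omega\times\Omega:\forall A\in\mathcal{G},\ (\omega\in A\Leftrightarrow\omega'\in A)\}$. $\mathcal{P}(\Omega,\mathcal{F})$ is the set of probability measures on $(\Omega,\mathcal{F})$, and $\Pi(\mathbb{P},\mathbb{P}')$ is the set of probability measures on $(\Omega\times\Omega,\mathcal{F}\otimes\mathcal{F})$ with marginals $\mathbb{P}$ and $\mathbb{P}'$. A pair $(E,\mathcal{G})$ of an equivalence relation on $\Omega$ and a sub-$\sigma$-algebra of $\mathcal{F}$ satisfies strong duality if $E\in\mathcal{F}\otimes\mathcal{F}$ and, for all $\mathbb{P},\mathbb{P}'\in\mathcal{P}(\Omega,\mathcal{F})$, $$\max_{A\in\mathcal{G}}|\mathbb{P}(A)-\mathbb{P}'(A)|=\min_{\tilde{\mathbb{P}}\in\Pi(\mathbb{P},\mathbb{P}')}(1-\tilde{\mathbb{P}}(E)),$$ where max and min assert that the supremum and infimum are both attained. A sub-$\sigma$-algebra $\mathcal{G}$ is strongly dualizable if the pair $(\mathcal{G}^{\ast},\mathcal{G})$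 satisfies strong duality. *)

(* Defs.v *)
From HB Require Import structures.
From Corelib Require Import RelationClasses.
From mathcomp Require Import all_boot all_order all_algebra.
From mathcomp Require Import all_classical all_reals all_analysis.

Set Implicit Arguments.
Unset Strict Implicit.
Unset Printing Implicit Defensive.

Import Order.TTheory GRing.Theory Num.Theory.

Local Open Scope classical_set_scope.
Local Open Scope ereal_scope.

(* First clause: completeness, as in [cauchy_cvg] of [completeType]; [cvg] itself
   and [completeType] are only available on pointed types. *)
Definition polish_metric (R : realType) (X : metricType R) : Prop :=
  (forall F : set_system X, ProperFilter F -> cauchy F ->
     exists x : X, F --> x) /\
  (exists2 D : set X, countable D & dense D).

(* f is an isomorphism onto a Polish space with its Borel sigma-algebra. *)
Definition standard_borel (R : realType) (d : measure_display)
    (T : measurableType d) : Prop :=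
  exists (X : metricType R) (f : T -> X),
    [/\ polish_metric X, bijective f &
        forall A : set T, measurable A <-> <<s @open X >> (f @` A)].

Definition sigma_subalgebra (d : measure_display) (T : measurableType d)
    (G : set (set T)) : Prop :=
  sigma_algebra setT G /\ G `<=` measurable.

Definition countably_generated (T : Type) (G : set (set T)) : Prop :=
  exists2 C : set (set T), countable C & G = <<s C >>.

Definition indist (T : Type) (G : set (set T)) : set (T * T) :=
  [set w | forall A, G A -> (A w.1 <-> A w.2)].

(* The marginals are compared on measurable sets only, since the value of a
   [probability] on a nonmeasurable set carries no information. *)
Definition couplings (R : realType) (d : measure_display)
    (T : measurableType d) (P P' : probability T R) :
    set (probability (T * T)%type R) :=
  [set Q | forall A : set T, measurable A ->
     pushforward Q fst A = P A /\ pushforward Q snd A = P' A].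

Definition strong_duality (R : realType) (d : measure_display)
    (T : measurableType d) (E : set (T * T)) (G : set (set T)) : Prop :=
  [/\ Equivalence (fun x y : T => E (x, y)),
      sigma_subalgebra G,
      measurable E &
      forall P P' : probability T R,
        let V : set (\bar R) := [set `|P A - P' A| | A in G] in
        let C : set (\bar R) := [set 1 - Q E | Q in couplings P P'] in
        [/\ V (ereal_sup V), C (ereal_inf C) & ereal_sup V = ereal_inf C]].

Definition strongly_dualizable (R : realType) (d : measure_display)
    (T : measurableType d) (G : set (set T)) : Prop :=
  strong_duality R (indist G) G.

(* Main.v *)
(* Write E_n and E for the equivalence relations of G_n and G.  The E_n increase
   to E.  Starting from P and P', at stage n couple as much as possible of the
   two remaining measures mu, nu along E_n: on the set A_n of G_n where mu
   dominates nu all of nu is coupled, on its complement all of mu.  Hence after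
   stage n the remainders are carried by disjoint sets of G_n; in the limit they
   are carried by limsup A_n, which lies in G, and by its complement.  The mass
   left over is then |P(A) - P'(A)| for A = limsup A_n, and it bounds the
   probability of the complement of E under any completion of the coupling.

   Coupling along the countably generated E_n avoids disintegration.  For a finite
   subalgebra the coupling is a sum of product measures over its atoms; an
   ultrafilter limit over an increasing sequence of finite subalgebras is a
   finitely additive coupling, and since its marginals are tight (Omega is
   isomorphic to a Polish space) its restriction to measurable rectangles is
   countably additive and extends to a measure. *)
Require Import Defs.
From HB Require Import structures.
From mathcomp Require Import all_boot all_order all_algebra.
From mathcomp Require Import all_classical all_reals all_analysis.

Set Implicit Arguments.
Unset Strict Implicit.
Unset Printing Implicit Defensive.
Import Order.TTheory GRing.Theory Num.Theory.
Import numFieldNormedType.Exports.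

Local Open Scope classical_set_scope.
Local Open Scope ring_scope.
Local Open Scope ereal_scope.

(** * Ultrafilter limits of measures *)

Lemma ultrafilter_fmap S T (f : S -> T) (F : set_system S) :
  UltraFilter F -> UltraFilter (f @ F).
Proof.
move=> FU; have FP : ProperFilter F by exact: ultra_proper.
split=> [|G GP FG]; first exact: fmap_proper_filter.
rewrite eqEsubset; split=> // A GA.
have [//|FA] := in_ultra_setVsetC (f @^-1` A) FU.
have GcA : G (~` A) by apply: FG; rewrite /fmap/= preimage_setC.
by have [x []] := filter_ex (filterI GA GcA).
Qed.

Section ultralimit.
Context (R : realType) (U : set_system nat) (UU : UltraFilter U).
Implicit Types (u : R ^nat) (M : R).

Let UP : ProperFilter U. Proof. exact: ultra_proper. Qed.
#[local] Existing Instance UP.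

(** An ultrafilter on the compact segment from 0 to [M] converges, so every bounded sequence has a
    limit along [U]. *)
Lemma ultralimit_cvg u M : (forall n, 0 <= u n <= M)%R -> cvg (u @ U).
Proof.
move=> uM.
have := @segment_compact R 0 M; rewrite compact_ultra => /(_ (u @ U)).
case.
- exact: ultrafilter_fmap.
- by apply: nearW => n /=; rewrite in_itv/= uM.
- by move=> l [_ ul]; apply/cvg_ex; exists l.
Qed.

Context d (T : measurableType d) (Q : {measure set T -> \bar R} ^nat) (M : R).
Hypothesis QM : forall k, Q k setT <= M%:E.

Let Q_le k A : measurable A -> Q k A <= M%:E.
Proof. by move=> mA; apply: le_trans (QM k); apply: le_measure; rewrite ?inE. Qed.

Let Q_fin k A : measurable A -> Q k A \is a fin_num.
Proof. by move=> mA; rewrite ge0_fin_numE// (le_lt_trans (Q_le k mA)) ?ltry. Qed.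

(** On measurable sets the values are bounded by [M], so the limit exists. The default 0 elsewhere
    keeps the function nonnegative on all sets, as a content demands. *)
Definition ultralimit A : \bar R :=
  if `[< measurable A >] then (lim (fine (Q k A) @[k --> U]))%:E else 0.

Let limP A : measurable A -> fine (Q k A) @[k --> U] --> lim (fine (Q k A) @[k --> U]).
Proof.
move=> mA; apply: (@ultralimit_cvg _ M) => k.
by rewrite fine_ge0//= -lee_fin fineK ?Q_fin// Q_le.
Qed.

Let ultralimitE A : measurable A ->
  ultralimit A = (lim (fine (Q k A) @[k --> U]))%:E.
Proof. by move=> mA; rewrite /ultralimit asboolT. Qed.

Lemma ultralimit_le A b : measurable A -> (\forall k \near U, Q k A <= b) ->
  ultralimit A <= b.
Proof.
move=> mA Qb; rewrite ultralimitE//.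
move: b Qb => [b Qb| |]; [|by rewrite leey|]; last first.
  by move=> /filter_ex[k] /(le_trans (measure_ge0 (Q k) A)).
rewrite lee_fin; apply: (closed_cvg (fun x => x <= b)%R (@closed_le _ b) _ _ (limP mA)).
by apply: filterS Qb => k; rewrite -lee_fin fineK// Q_fin.
Qed.

Lemma ultralimit_ge A b : measurable A -> (\forall k \near U, b <= Q k A) ->
  b <= ultralimit A.
Proof.
move=> mA Qb; rewrite ultralimitE//.
move: b Qb => [b Qb| |]; [| |by rewrite leNye]; last first.
  by move=> /filter_ex[k] /le_trans/(_ (Q_le k mA)).
rewrite lee_fin; apply: (closed_cvg (fun x => b <= x)%R (@closed_ge _ b) _ _ (limP mA)).
by apply: filterS Qb => k; rewrite -lee_fin fineK// Q_fin.
Qed.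

Let ultralimit_ge0 A : 0 <= ultralimit A.
Proof.
rewrite /ultralimit; case: asboolP => // mA; rewrite -ultralimitE//.
by apply: ultralimit_ge => //; exact: nearW.
Qed.

Let ultralimit0 : ultralimit set0 = 0.
Proof.
apply/eqP; rewrite eq_le ultralimit_ge0 andbT.
by apply: ultralimit_le => //; apply: nearW => k; rewrite measure0.
Qed.

Let ultralimit_additive : measure_function.semi_additive ultralimit.
Proof.
apply/(additive2P ultralimit0) => A B mA mB AB.
rewrite !ultralimitE//; last exact: measurableU.
rewrite -EFinD; congr EFin; apply: cvg_lim => //.
under eq_fun do rewrite measureU// fineD ?Q_fin//.
exact: cvgD (limP mA) (limP mB).
Qed.

Lemma ultralimit_content :
  exists q : {content set T -> \bar R}, q = ultralimit :> (set T -> \bar R).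
Proof.
pose C := isContent.Build _ T R ultralimit ultralimit_ge0 ultralimit_additive.
pose q : {content set T -> \bar R} := HB.pack ultralimit C.
by exists q.
Qed.

End ultralimit.

(** The ultrafilter refines the filter at infinity, so bounds that hold eventually pass to the
    limit; these bounds and finite additivity are all that is kept of it. Countable additivity can
    be lost, hence a content and not a measure. *)
Lemma exists_ultralimit_content (R : realType) d (T : measurableType d)
    (Q : {measure set T -> \bar R} ^nat) (M : R) :
  (forall k, Q k setT <= M%:E) ->
  exists q : {content set T -> \bar R}, forall A b, measurable A ->
    ((\forall k \near \oo, Q k A <= b) -> q A <= b) /\
    ((\forall k \near \oo, b <= Q k A) -> b <= q A).
Proof.
move=> QM; have [U [UU ooU]] := @ultraFilterLemma _ \oo _.
have [q qE] := ultralimit_content UU QM.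
exists q => A b mA; rewrite qE; split=> /ooU Qb.
- exact: ultralimit_le QM _ _ mA Qb.
- exact: ultralimit_ge QM _ _ mA Qb.
Qed.

(** * Extension of contents from measurable rectangles *)

(* An alias, because [T1 * T2] already carries the product sigma-algebra. *)
Definition rectangle_type (T1 T2 : Type) : Type := T1 * T2.

(** Opaque, so that measurability in the semiring of rectangles is not mistaken for measurability in
    the product, whose display has the same value. *)
Definition rectangle_display : measure_display -> measure_display -> measure_display.
Proof. exact: (fun d1 d2 => (d1, d2).-prod%mdisp). Qed.

Section rectangle_semiring.
Context d1 d2 (T1 : measurableType d1) (T2 : measurableType d2).

Definition rectangle : set (set (T1 * T2)) :=
  [set A `*` B | A in measurable & B in measurable].

Let rectangle0 : rectangle set0.
Proof. by exists set0 => //; exists set0 => //; rewrite set0X. Qed.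

Let rectangleI : setI_closed rectangle.
Proof.
move=> _ _ [A mA [B mB <-]] [C mC [D mD <-]].
exists (A `&` C); first exact: measurableI.
by exists (B `&` D); [exact: measurableI|rewrite setXI].
Qed.

Let rectangleD : semi_setD_closed rectangle.
Proof.
move=> _ _ [A mA [B mB <-]] [C mC [D mD <-]].
exists [set (A `\` C) `*` B; (A `&` C) `*` (B `\` D)]; split.
- exact: finite_set2.
- move=> _ [->|->].
  + by exists (A `\` C); [exact: measurableD|exists B].
  + by exists (A `&` C); [exact: measurableI|exists (B `\` D) => //; exact: measurableD].
- apply/seteqP; split=> [[x y] /= [[Ax By] CD]|[x y]/=].
  + have [Cx|nCx] := pselect (C x).
    * by exists ((A `&` C) `*` (B `\` D)); [right|do 2 split => //; move=> Dy; exact: CD].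
    * by exists ((A `\` C) `*` B); [left|].
  + by move=> [_ [->|->]] /= [[Ax Cx]]; [move=> By|move=> [By nDy]]; split=> // -[].
- by move=> _ _ [->|->] [->|->] //= [[x y] /= [[[? ?] ?]] [[? ?] ?]].
Qed.

HB.instance Definition _ := Pointed.on (rectangle_type T1 T2).
HB.instance Definition _ := isSemiRingOfSets.Build (rectangle_display d1 d2)
  (rectangle_type T1 T2) rectangle0 rectangleI rectangleD.

Context (R : realType) (q : {content set (T1 * T2)%type -> \bar R}).

Lemma rectangle_measurable A : rectangle A -> measurable A.
Proof. by move=> [B mB [C mC <-]]; exact: measurableX. Qed.

(** Caratheodory extension: a countably subadditive content on the semiring of rectangles is a
    measure there and extends to the generated sigma-algebra, which is the product one. Agreement
    with [q] is claimed on rectangles only. *)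
Lemma rectangle_content_extension :
  (forall A F, rectangle A -> (forall n, rectangle (F n)) ->
     A `<=` \bigcup_n F n -> q A <= \sum_(n <oo) q (F n)) ->
  exists Q : {measure set (T1 * T2)%type -> \bar R},
    forall A, rectangle A -> Q A = q A.
Proof.
move=> q_sub; pose q' : set (rectangle_type T1 T2) -> \bar R := q.
have q'_add : measure_function.semi_additive q'.
  move=> F n mF tF mUF; apply: measure_semi_additive => //.
    by move=> k; apply: rectangle_measurable; exact: mF.
  exact: rectangle_measurable.
pose C := isContent.Build _ _ _ q' (measure_ge0 q) q'_add.
pose qC : {content set (rectangle_type T1 T2) -> \bar R} := HB.pack q' C.
have qC_sub : measurable_subset_sigma_subadditive qC by move=> A F mF mA; exact: q_sub.
pose M := Content_SigmaSubAdditive_isMeasure.Build _ _ _ qC qC_sub.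
pose qM : {measure set (rectangle_type T1 T2) -> \bar R} := HB.pack q' C M.
pose Q : set (T1 * T2)%type -> \bar R := measure_extension qM.
have rectE : (measurable : set (set (T1 * T2))) =
    <<s (measurable : set (set (rectangle_type T1 T2))) >>.
  by rewrite measurable_prod_measurableType.
have Qadd : semi_sigma_additive Q.
  move=> F mF tF mUF; apply: measure_semi_sigma_additive => //.
  - by move=> i; have := mF i; rewrite rectE.
  - by move: mUF; rewrite rectE.
pose D := isMeasure.Build _ _ _ Q (measure0 (measure_extension qM))
  (measure_ge0 (measure_extension qM)) Qadd.
pose QM : {measure set (T1 * T2)%type -> \bar R} := HB.pack Q D.
by exists QM => A rA; rewrite /QM/= /Q /measure_extension measurable_mu_extE.
Qed.

End rectangle_semiring.

(** * Regularity and tightness on Polish spaces *)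

(** The point [x0] fills the indices that no point of [D] claims, so that [D] may be empty. *)
Lemma countable_range T (D : set T) (x0 : T) : countable D ->
  exists2 g : nat -> T, D `<=` range g & range g `<=` D `|` [set x0].
Proof.
move=> /countable_injP[h hinj].
have /choice[g gP] : forall n, exists x, (forall y, D y -> h y = n -> x = y) /\
    (D x \/ x = x0).
  move=> n; have [[y [Dy hy]]|nex] := pselect (exists y, D y /\ h y = n).
    exists y; split; last by left.
    by move=> z Dz hz; apply: hinj; rewrite ?inE// hz.
  by exists x0; split; [move=> y Dy hy; case: nex; exists y|right].
exists g; first by move=> y Dy; exists (h y) => //; exact: (gP (h y)).1.
by move=> _ [n _ <-]; exact: (gP n).2.
Qed.

Lemma preimage_setD aT rT (f : aT -> rT) (A B : set rT) :
  f @^-1` (A `\` B) = f @^-1` A `\` f @^-1` B.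
Proof. exact/predeqP. Qed.

Section finite_measure_approximation.
Context (R : realType) d (T : measurableType d).
Context (mu : {finite_measure set T -> \bar R}).

(** Continuity from above: the differences decrease to the empty set. *)
Lemma nondecreasing_exhaust (G : (set T)^nat) (e : R) :
  (forall n, measurable (G n)) -> nondecreasing_seq G -> (0 < e)%R ->
  exists n, mu ((\bigcup_k G k) `\` G n) <= e%:E.
Proof.
move=> mG ndG e0; apply/not_existsP => H.
have mU : measurable (\bigcup_k G k) by exact: bigcup_measurable.
have mD n : measurable ((\bigcup_k G k) `\` G n) by exact: measurableD.
have cap0 : \bigcap_n ((\bigcup_k G k) `\` G n) = set0.
  rewrite -subset0 => x Gx; have [[k _ Gkx] _] := Gx 0%N I.
  by have [_] := Gx k I.
have : mu ((\bigcup_k G k) `\` G n) @[n --> \oo] --> 0.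
  rewrite -(measure0 mu) -cap0; apply: nonincreasing_cvg_mu => //.
  - by rewrite -ge0_fin_numE// fin_num_measure.
  - by rewrite cap0.
  - by move=> m n mn; apply/subsetPset; apply: setDS; apply/subsetPset; exact: ndG.
move=> cv; suff : e%:E <= 0 by rewrite lee_fin leNgt e0.
rewrite -(cvg_lim _ cv)//; apply: lime_ge; first by apply/cvg_ex; exists 0.
by apply: nearW => n; rewrite leNgt; apply/negP => /ltW; exact: H.
Qed.

Context (X : metricType R) (f : T -> X).
Hypothesis mf : forall U, open U -> measurable (f @^-1` U).

Let mfC C : closed C -> measurable (f @^-1` C).
Proof.
by move=> cC; rewrite -[C]setCK -preimage_setC; apply/measurableC/mf; exact: closed_openC.
Qed.

(** Inner closed and outer open approximation are required together, which makes the class stable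
    under complement. *)
Definition regular (A : set X) := measurable (f @^-1` A) /\
  forall e : R, (0 < e)%R -> exists F U,
    [/\ closed F, open U, F `<=` A, A `<=` U & mu (f @^-1` (U `\` F)) <= e%:E].

(** An open set is the increasing union of the closed sets [F n] of points that stay about 1/(n+1)
    away from its complement. *)
Lemma regular_open A : open A -> regular A.
Proof.
move=> oA; split; [exact: mf|move=> e e0].
pose r n : R := n.+1%:R^-1%R.
have r0 n : (0 < r n)%R by rewrite /r invr_gt0.
pose F n := ~` \bigcup_(y in ~` A) (ball y (r n))°.
have cF n : closed (F n).
  by apply: open_closedC; apply: bigcup_open => y _; exact: open_interior.
have FA n : F n `<=` A.
  move=> x; apply: contraPP => nAx; apply; exists x => //.
  exact: nbhsx_ballx.
have UF : \bigcup_n (f @^-1` F n) = f @^-1` A.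
  apply/seteqP; split=> [x [n _ /FA]//|x /= Afx].
  have /nbhs_ballP[s /= s0 sA] : nbhs (f x) A by exact: open_nbhs_nbhs.
  have [n nr] : exists n, (r n < s)%R.
    by have [n] := ltr_add_invr (s0 : (0 < s)%R); rewrite add0r; exists n.
  exists n => // -[y nAy /interior_subset yx]; apply/nAy/sA.
  by apply/ball_sym; apply: le_ball yx; exact: ltW.
have [n|m n mn|n en] := @nondecreasing_exhaust (fun n => f @^-1` F n) e _ _ e0.
- exact: mfC.
- apply/subsetPset; apply: preimage_subset; apply: subsetC.
  apply: subset_bigcup => y _; apply: interiorS; apply: le_ball.
  by rewrite /r lef_pV2 ?posrE// ler_nat.
- exists (F n), A; split => //; move: en; rewrite UF.
  by rewrite -preimage_setD.
Qed.

(** Complements swap the two approximants. For a countable union, the errors of the individual sets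
    sum to e/2; the inner closed sets must moreover be cut to a finite union to remain closed, which
    costs another e/2. *)
Lemma regular_sigma_algebra : sigma_algebra setT regular.
Proof.
split.
- split; first by rewrite preimage_set0.
  move=> e e0; exists set0, set0; split => //; [exact: closed0|exact: open0|].
  by rewrite setD0 preimage_set0 measure0 lee_fin ltW.
- move=> A [mA regA]; rewrite setTD; split.
    by rewrite -preimage_setC; exact: measurableC.
  move=> e /regA[F [U [cF oU FA AU UFe]]]; exists (~` U), (~` F); split.
  + exact: open_closedC.
  + exact: closed_openC.
  + exact: subsetC.
  + exact: subsetC.
  + by rewrite setDE setCK setIC -setDE.
- move=> A regA.
  have mA n : measurable (f @^-1` A n) by exact: (regA n).1.
  split; first by rewrite preimage_bigcup; exact: bigcup_measurable.
  move=> e e0; have e20 : (0 < e / 2)%R by rewrite divr_gt0.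
  have /choice[FU FUP] : forall n, exists FU : set X * set X,
      [/\ closed FU.1, open FU.2, FU.1 `<=` A n, A n `<=` FU.2 &
        mu (f @^-1` (FU.2 `\` FU.1)) <= (e / 2 / (2 ^ n.+1)%:R)%:E].
    move=> n; have [|F [U FUP]] := (regA n).2 (e / 2 / (2 ^ n.+1)%:R)%R.
      by rewrite divr_gt0.
    by exists (F, U).
  have mF n : measurable (f @^-1` (FU n).1) by have [/mfC] := FUP n.
  have mU n : measurable (f @^-1` (FU n).2) by have [_ /mf] := FUP n.
  pose G n := \big[setU/set0]_(i < n) (FU i).1.
  have cG n : closed (G n) by apply: closed_bigsetU => i _; have [] := FUP i.
  have GE n : G n = \bigcup_(i < n) (FU i).1 by rewrite bigcup_mkord.
  have GU : \bigcup_n (f @^-1` G n) = \bigcup_n (f @^-1` (FU n).1).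
    apply/seteqP; split=> [x [n _]|x [n _ Fx]].
      by rewrite GE => -[i _ Fx]; exists i.
    by exists n.+1 => //; rewrite GE; exists n => /=.
  have [n|m n mn|n nP] := @nondecreasing_exhaust (fun n => f @^-1` G n) (e / 2)%R _ _ e20.
  + exact: mfC.
  + apply/subsetPset; apply: preimage_subset.
    exact: (@subset_bigsetU _ (fun i => (FU i).1) _ _ mn).
  exists (G n), (\bigcup_n (FU n).2); split => //.
  + by apply: bigcup_open => i _; have [] := FUP i.
  + rewrite GE => x [i _ Fx]; exists i => //.
    by have [_ _ FA _ _] := FUP i; exact: FA.
  + by apply: subset_bigcup => i _; have [] := FUP i.
  set B := f @^-1` _.
  set C := (\bigcup_n (f @^-1` G n)) `\` f @^-1` G n in nP.
  have mC : measurable C.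
    apply: measurableD; last exact: mfC.
    by apply: bigcup_measurable => k _; exact: mfC.
  pose D := \bigcup_n (f @^-1` ((FU n).2 `\` (FU n).1)).
  have mDn k : measurable (f @^-1` ((FU k).2 `\` (FU k).1)).
    by rewrite preimage_setD; exact: measurableD.
  have mD : measurable D by exact: bigcup_measurable.
  have BCD : B `<=` C `|` D.
    move=> x [[k _ Ux] nGx].
    have [[i _ Fx]|nF] := pselect ((\bigcup_n (f @^-1` (FU n).1)) x).
      by left; split => //; rewrite GU; exists i.
    by right; exists k => //; split => // Fx; apply: nF; exists k.
  have mB : measurable B.
    rewrite /B preimage_setD; apply: measurableD; last exact: mfC.
    by rewrite preimage_bigcup; exact: bigcup_measurable.
  rewrite (@le_trans _ _ (mu (C `|` D)))//.
    by apply: le_measure; rewrite ?inE//; exact: measurableU.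
  rewrite (le_trans (measureU2 _ _ _))// [leRHS](_ : _ = (e / 2)%:E + (e / 2)%:E); last first.
    by rewrite -EFinD -splitr.
  rewrite leeD// (le_trans (generalized_Boole_inequality _ _ _))//.
  rewrite (le_trans _ (epsilon_trick0 xpredT (ltW e20)))//.
  by apply: lee_nneseries => // k _; have [] := FUP k.
Qed.

Lemma regular_borel A : <<s @open X >> A -> regular A.
Proof.
by apply: smallest_sub; [exact: regular_sigma_algebra|exact: regular_open].
Qed.

(** Ulam's argument: at scale 1/(n+1) finitely many closed balls around a dense sequence carry all
    but e/2^(n+1) of the mass. The intersection over all scales is closed and totally bounded, hence
    compact by completeness. *)
Lemma polish_tight (e : R) : polish_metric X -> (0 < e)%R ->
  exists K : set X, [/\ compact K, closed K & mu (f @^-1` ~` K) <= e%:E].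
Proof.
move=> [Xcomplete [D cD dD]] e0.
have [g Dg _] := countable_range (f point) cD.
pose r n : R := n.+1%:R^-1%R.
have r0 n : (0 < r n)%R by rewrite /r invr_gt0.
pose B n N := \big[setU/set0]_(i < N) closed_ball (g i) (r n).
have BE n N : B n N = \bigcup_(i < N) closed_ball (g i) (r n) by rewrite bigcup_mkord.
have cB n N : closed (B n N).
  by apply: closed_bigsetU => i _; exact: closed_ball_closed.
have BT n : \bigcup_N (f @^-1` B n N) = setT.
  rewrite -subTset => x _.
  have [|y [/interior_subset bxy /Dg[i _ gi]]] := dD (ball (f x) (r n))° _ (@open_interior _ _).
    by exists (f x); exact: nbhsx_ballx.
  exists i.+1 => //=; rewrite BE; exists i => //=.
  by apply: subset_closed_ball; rewrite gi; exact: ball_sym.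
have /choice[N NP] : forall n, exists N,
    mu (f @^-1` ~` B n N) <= (e / (2 ^ n.+1)%:R)%:E.
  move=> n; have [| | |M MP] := @nondecreasing_exhaust (fun N => f @^-1` B n N)
    (e / (2 ^ n.+1)%:R)%R _ _ _.
  - by move=> k; exact: mfC.
  - move=> k l kl; apply/subsetPset; apply: preimage_subset.
    exact: (@subset_bigsetU _ (fun i => closed_ball (g i) (r n)) _ _ kl).
  - by rewrite divr_gt0.
  - by exists M; move: MP; rewrite BT setTD preimage_setC.
pose K := \bigcap_n B n (N n).
have cK : closed K by apply: closed_bigI.
exists K; split => //; last first.
  rewrite /K setC_bigcap preimage_bigcup.
  have mB n : measurable (f @^-1` ~` B n (N n)) by apply/mf/closed_openC.
  rewrite (le_trans (generalized_Boole_inequality _ _ _))//.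
    exact: bigcup_measurable.
  rewrite (le_trans _ (epsilon_trick0 xpredT (ltW e0)))//.
  by apply: lee_nneseries => // k _; exact: NP.
(* At each scale an ultrafilter on [K] contains one of the finitely many balls covering [K]. So it
   is Cauchy, completeness supplies a limit, and the limit lies in [K] because [K] is closed. *)
rewrite compact_ultra => F UF FK.
have PF : ProperFilter F by exact: ultra_proper.
have [x Fx] : exists x : X, F --> x.
  apply: Xcomplete => //; apply: cauchy_exP => s s0.
  have [n ns] : exists n, (r n < s / 2)%R.
    by have [|n] := @ltr_add_invr R 0 (s / 2); [rewrite divr_gt0|rewrite add0r; exists n].
  have : F (B n (N n)) by apply: filterS FK => y; exact.
  rewrite /B; elim: (N n) => [|k IH]; first by rewrite big_ord0 => /filter_ex[].
  rewrite big_ord_recr/=.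
  have [FB|FC] := in_ultra_setVsetC (closed_ball (g k) (r n)) UF.
    move=> _; exists (g k); apply: filterS FB => y.
    by move=> /(le_closed_ball (ltW ns)); exact: subset_closure_half.
  move=> /(filterI FC) FU; apply: IH; apply: filterS FU => y [nBy].
  by case.
exists x; split=> //; apply: cK => A /Fx FA.
exact: filter_ex (filterI FK FA).
Qed.

(** A closed set inside [A] is intersected with a compact set carrying almost all the mass; each of
    the two costs e/2. *)
Lemma polish_inner_compact (A : set X) (e : R) : polish_metric X ->
  <<s @open X >> A -> (0 < e)%R ->
  exists K, [/\ compact K, measurable (f @^-1` K), K `<=` A & mu (f @^-1` (A `\` K)) <= e%:E].
Proof.
move=> pX bA e0; have e20 : (0 < e / 2)%R by rewrite divr_gt0.
have [mA /(_ _ e20)[F [U [cF oU FA AU UF]]]] := regular_borel bA.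
have [K [kK cK Ke]] := polish_tight pX e20.
exists (K `&` F); split.
- exact: compact_closedI.
- by apply: mfC; exact: closedI.
- by move=> x [_ /FA].
have mK : measurable (f @^-1` ~` K) by exact/mf/closed_openC.
have mUF : measurable (f @^-1` (U `\` F)).
  by rewrite preimage_setD; apply: measurableD; [exact: mf|exact: mfC].
apply: (@le_trans _ _ (mu (f @^-1` (~` K) `|` f @^-1` (U `\` F)))).
  apply: le_measure; rewrite ?inE.
  - by rewrite preimage_setD; apply: measurableD => //; by apply: mfC; exact: closedI.
  - exact: measurableU.
  - move=> x [Ax nKF]; have [Kx|] := pselect (K (f x)); last by left.
    by right; split; [exact: AU|move=> Fx; exact: nKF].
rewrite (le_trans (measureU2 _ _ _))// [leRHS](_ : _ = (e / 2)%:E + (e / 2)%:E) ?leeD//.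
by rewrite -EFinD -splitr.
Qed.

End finite_measure_approximation.

(** * Finitely additive couplings with tight marginals *)

Definition borel_isomorphism (R : realType) d (T : measurableType d)
    (X : metricType R) (f : T -> X) :=
  bijective f /\ forall A : set T, measurable A <-> <<s @open X >> (f @` A).

Section borel_isomorphism.
Context (R : realType) d (T : measurableType d) (X : metricType R) (f : T -> X).
Hypothesis fB : borel_isomorphism f.
Context (mu : {finite_measure set T -> \bar R}).

Let imageK : cancel (fun B : set T => f @` B) (fun A => f @^-1` A).
Proof.
move=> B; have [/bij_inj finj _] := fB.
by apply/seteqP; split=> [x [y By /finj <-]//|x Bx]; exists x.
Qed.

Lemma borel_isomorphism_range (A : set X) : f @` (f @^-1` A) = A.
Proof.
have [[g fK gK] _] := fB.
by apply/seteqP; split=> [_ [x fAx <-]//|y Ay]; exists (g y); rewrite /= gK.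
Qed.

Lemma measurable_preimage_open (U : set X) : open U -> measurable (f @^-1` U).
Proof.
move=> oU; apply/(fB.2 _).2; rewrite borel_isomorphism_range.
exact: sub_sigma_algebra.
Qed.

Lemma inner_compact (B : set T) (e : R) : polish_metric X -> measurable B ->
  (0 < e)%R -> exists K : set X, [/\ compact K, measurable (f @^-1` K),
    f @^-1` K `<=` B & mu (B `\` f @^-1` K) <= e%:E].
Proof.
move=> pX /(fB.2 _).1 bB e0.
have [K [cK mK KB Ke]] :=
  polish_inner_compact mu measurable_preimage_open pX bB e0.
exists K; split => //; first by rewrite -(imageK B); exact: preimage_subset.
by move: Ke; rewrite preimage_setD imageK.
Qed.

Lemma outer_open (B : set T) (e : R) : measurable B -> (0 < e)%R ->
  exists U : set X, [/\ open U, measurable (f @^-1` U), B `<=` f @^-1` U &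
    mu (f @^-1` U `\` B) <= e%:E].
Proof.
move=> mB e0; have bB := (fB.2 _).1 mB.
have [_ /(_ _ e0)[F [U [cF oU FB BU Ue]]]] :=
  regular_borel mu measurable_preimage_open bB.
have mU := measurable_preimage_open oU.
exists U; split => //; first by rewrite -(imageK B); exact: preimage_subset.
apply: le_trans Ue; apply: le_measure; rewrite ?inE.
- exact: measurableD.
- rewrite preimage_setD; apply: measurableD => //.
  rewrite -[F]setCK -preimage_setC; apply/measurableC/measurable_preimage_open.
  exact: closed_openC.
- move=> x [Ux nBx]; split => // /FB [y By yx]; apply: nBx.
  by rewrite -(imageK B); exists y.
Qed.

End borel_isomorphism.

(** The near-covering form of compactness, used with the filter at infinity, makes one bound on the
    index serve all points of [K]. *)
Lemma compact_cover_nat (X : topologicalType) (K : set X) (W : (set X)^nat) :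
  compact K -> (forall n, open (W n)) -> K `<=` \bigcup_n W n ->
  exists n, K `<=` \bigcup_(i < n) W i.
Proof.
move=> /compact_near_coveringP cK oW KW.
have [x /KW[i _ Wix]|n _ nK] :=
    cK nat \oo (fun n x => exists2 i, (i < n)%N & W i x) _ _.
  exists (W i, [set n | (i < n)%N]) => /=.
    by split; [exact: open_nbhs_nbhs|exists i.+1].
  by move=> [y n] /= [Wiy ni]; exists i.
by exists n => x /(nK n (leqnn _))[i ni Wix]; exists i.
Qed.

Section tight_content.
Context (R : realType) d1 d2 (T1 : measurableType d1) (T2 : measurableType d2).
Context (q : {content set (T1 * T2)%type -> \bar R}).
Context (mu1 : {finite_measure set T1 -> \bar R}).
Context (mu2 : {finite_measure set T2 -> \bar R}).
Hypothesis q_mu1 : forall B, measurable B -> q (B `*` setT) <= mu1 B.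
Hypothesis q_mu2 : forall C, measurable C -> q (setT `*` C) <= mu2 C.

(** The rectangle on [B'] and [C'] is covered by the one on [B] and [C] and two strips, whose
    contents the marginals bound. Approximating the sides thus approximates the rectangle. *)
Lemma content_rectangle_le (B B' : set T1) (C C' : set T2) :
  measurable B -> measurable B' -> measurable C -> measurable C' ->
  q (B' `*` C') <= q (B `*` C) + (mu1 (B' `\` B) + mu2 (C' `\` C)).
Proof.
move=> mB mB' mC mC'.
have mBB : measurable (B' `\` B) by exact: measurableD.
have mCC : measurable (C' `\` C) by exact: measurableD.
have mX := measurableX.
apply: (@le_trans _ _ (q ((B `*` C) `|` ((B' `\` B) `*` setT `|` setT `*` (C' `\` C))))).
  apply: le_measure; rewrite ?inE; first exact: mX.
    by apply: measurableU; [exact: mX|apply: measurableU; exact: mX].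
  move=> [x y] /= [B'x C'y].
  have [Bx|nBx] := pselect (B x); last by right; left.
  by have [Cy|nCy] := pselect (C y); [left|right; right].
have U2 (A D : set (T1 * T2)) : measurable A -> measurable D ->
    q (A `|` D) <= q A + q D.
  move=> mA mD.
  rewrite (_ : A `|` D = A `|` (D `\` A)); last first.
    apply/seteqP; split=> [z [|Dz]|z [|[]]]; [by left| |by left|by right].
    by have [Az|nAz] := pselect (A z); [left|right].
  rewrite measureU//; [|exact: measurableD|by rewrite setDE setICA setICr setI0].
  by rewrite leeD2l//; apply: le_measure; rewrite ?inE//; exact: measurableD.
rewrite (le_trans (U2 _ _ _ _))//; [exact: mX|by apply: measurableU; exact: mX|].
rewrite leeD2l// (le_trans (U2 _ _ _ _))//; [exact: mX|exact: mX|].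
by rewrite leeD// ?q_mu1 ?q_mu2.
Qed.

Hypothesis sb1 : standard_borel R T1.
Hypothesis sb2 : standard_borel R T2.

(* Marczewski-Ryll-Nardzewski: tight marginals force a finitely additive
   coupling to be countably additive on rectangles. *)
Lemma tight_content_subadditive A (F : (set (T1 * T2)%type)^nat) :
  rectangle A -> (forall n, rectangle (F n)) ->
  A `<=` \bigcup_n F n -> q A <= \sum_(n <oo) q (F n).
Proof.
move=> [B mB [C mC <-]] rF BCF; apply/lee_addgt0Pr => e e0.
have [X1 [f1 [pX1 bf1 Hf1]]] := sb1.
have [X2 [f2 [pX2 bf2 Hf2]]] := sb2.
have fB1 : borel_isomorphism f1 by [].
have fB2 : borel_isomorphism f2 by [].
(* The error budget: e/4 for each of the compact sets [K] and [L], and e/4 divided by 2^(n+1) for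
   each side of the n-th rectangle, so that the two series of errors add up to e/2. *)
have e4 : (0 < e / 2 / 2)%R by rewrite !divr_gt0.
have /choice[BC BCP] : forall n, exists BC : set T1 * set T2,
    [/\ measurable BC.1, measurable BC.2 & F n = BC.1 `*` BC.2].
  by move=> n; have [B' mB' [C' mC' <-]] := rF n; exists (B', C').
pose en n : R := (e / 2 / 2 / (2 ^ n.+1)%:R)%R.
have en0 n : (0 < en n)%R by rewrite divr_gt0.
have /choice[U UP] : forall n, exists U : set X1, [/\ open U, measurable (f1 @^-1` U),
    (BC n).1 `<=` f1 @^-1` U & mu1 (f1 @^-1` U `\` (BC n).1) <= (en n)%:E].
  by move=> n; apply: outer_open => //; have [] := BCP n.
have /choice[V VP] : forall n, exists V : set X2, [/\ open V, measurable (f2 @^-1` V),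
    (BC n).2 `<=` f2 @^-1` V & mu2 (f2 @^-1` V `\` (BC n).2) <= (en n)%:E].
  by move=> n; apply: outer_open => //; have [] := BCP n.
have [K [cK mK KB Ke]] := inner_compact fB1 mu1 pX1 mB e4.
have [L [cL mL LC Le]] := inner_compact fB2 mu2 pX2 mC e4.
(* The open rectangles cover the compact product of [K] and [L], so finitely many do, and from here
   finite subadditivity of the content is enough. *)
have [|[x y] [/= Kx Ly]|N KLN] := @compact_cover_nat _ (K `*` L)
    (fun n => U n `*` V n) (compact_setX cK cL).
- move=> n; have [oU _ _ _] := UP n; have [oV _ _ _] := VP n.
  rewrite openE => -[x y] [/= Ux Vy]; exists (U n, V n) => //=.
  by split; exact: open_nbhs_nbhs.
- have : (f1 @` (f1 @^-1` K)) x by rewrite (borel_isomorphism_range fB1).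
  move=> [a /KB Ba <-].
  have : (f2 @` (f2 @^-1` L)) y by rewrite (borel_isomorphism_range fB2).
  move=> [b /LC Cb <-].
  have [//|n _] := BCF (a, b); have [_ _ ->] := BCP n => -[/= B'a C'b].
  exists n => //; split => /=.
  + by have [_ _ + _] := UP n; apply.
  + by have [_ _ + _] := VP n; apply.
have mUV n : measurable ((f1 @^-1` U n) `*` (f2 @^-1` V n)).
  by apply: measurableX; [have [] := UP n|have [] := VP n].
rewrite (le_trans (content_rectangle_le mK mB mL mC))//.
have -> : \sum_(n <oo) q (F n) + e%:E =
    \sum_(n <oo) q (F n) + (e / 2)%:E + ((e / 2 / 2)%:E + (e / 2 / 2)%:E).
  by rewrite -EFinD -splitr -addeA -EFinD -splitr.
rewrite leeD//; last exact: leeD.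
have e2 : (0 <= e / 2)%R by rewrite divr_ge0// ltW.
rewrite (le_trans _ (epsilon_trick xpredT _ e2))//.
apply: (@le_trans _ _ (\sum_(i < N) q ((f1 @^-1` U i) `*` (f2 @^-1` V i)))).
  apply: (@content_subadditive _ _ _ q _
    (fun i => (f1 @^-1` U i) `*` (f2 @^-1` V i))) => //; first exact: measurableX.
  rewrite -(bigcup_mkord N (fun i => (f1 @^-1` U i) `*` (f2 @^-1` V i))).
  move=> [a b] [/= Ka Lb].
  by have [|i iN UVi] := KLN (f1 a, f2 b) => //; exists i.
apply: (@le_trans _ _ (\sum_(i < N) (q (F i) + (e / 2 / (2 ^ i.+1)%:R)%:E))).
  apply: lee_sum => i _; have [mB' mC' ->] := BCP i.
  have [_ mUi _ Ue] := UP i; have [_ mVi _ Ve] := VP i.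
  rewrite (le_trans (content_rectangle_le mB' mUi mC' mVi))// leeD2l//.
  rewrite (le_trans (leeD Ue Ve))// -EFinD lee_fin /en.
  by rewrite -mulrDl -splitr.
rewrite -(big_mkord xpredT (fun i => q (F i) + (e / 2 / (2 ^ i.+1)%:R)%:E)).
apply: nneseries_lim_ge => n _ _; rewrite adde_ge0//.
by rewrite lee_fin divr_ge0.
Qed.

End tight_content.

(** * Indistinguishability and Hahn sets of a sub-sigma-algebra *)

Section indistinguishability.
Context (R : realType) d (T : measurableType d) (G : set (set T)).

(** The sets that do not separate two given points form a sigma-algebra, so two points separated by
    [G] are already separated by a generator. The sequence [A] enumerates the generators, padded
    with the empty set. *)
Lemma indist_countably_generated :
  sigma_algebra setT G -> countably_generated G ->
  exists2 A : (set T)^nat, (forall n, G (A n)) &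
    ~` indist G = \bigcup_n (A n `*` ~` A n `|` ~` A n `*` A n).
Proof.
move=> sG [C cC GC]; have [A CA AC] := countable_range set0 cC.
have [G0 _ _] := sG; exists A.
  move=> n; have /AC[CAn|->//] : range A (A n) by exists n.
  by rewrite GC; exact: sub_sigma_algebra.
apply/seteqP; split=> [[x y]|[x y] [n _ An] /(_ (A n))]; last first.
  have GA : G (A n).
    have /AC[CAn|->//] : range A (A n) by exists n.
    by rewrite GC; exact: sub_sigma_algebra.
  by move=> /(_ GA)/= [xy yx]; case: An => -[/= Ax Ay]; [exact/Ay/xy|exact/Ax/yx].
apply: contra_notP => nA B; rewrite GC; move: B.
pose D := [set B : set T | B x <-> B y].
apply: (@smallest_sub _ _ _ D); last first.
  move=> _ /CA[n _ <-]; split=> Anx; apply: contrapT => nAn; apply: nA; exists n => //.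
    by left.
  by right.
split=> [//|B Bxy|F Fxy].
  by rewrite setTD; split=> /= + By; apply; apply/Bxy.
by split=> -[n _ Fn]; exists n => //; apply/Fxy.
Qed.

Lemma measurable_indist : sigma_subalgebra G -> countably_generated G ->
  measurable (indist G).
Proof.
move=> [sG Gm] cG; have [A GA EA] := indist_countably_generated sG cG.
rewrite -[indist G]setCK EA; apply: measurableC.
apply: bigcup_measurable => n _; have mA := Gm _ (GA n).
by apply: measurableU; apply: measurableX => //; exact: measurableC.
Qed.

Lemma sigma_subalgebraC A : sigma_subalgebra G -> G A -> G (~` A).
Proof. by move=> [[_ + _] _] GA => /(_ _ GA); rewrite setTD. Qed.

Lemma sigma_subalgebraU A B : sigma_subalgebra G -> G A -> G B -> G (A `|` B).
Proof.
move=> [[G0 _ GU] _] GA GB; rewrite -bigcup2E.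
by apply: GU => -[|[|n]].
Qed.

Lemma sigma_subalgebraI A B : sigma_subalgebra G -> G A -> G B -> G (A `&` B).
Proof.
move=> sG GA GB; rewrite -[A]setCK -[B]setCK -setCU.
by apply/sigma_subalgebraC/sigma_subalgebraU => //; exact: sigma_subalgebraC.
Qed.

(** The Hahn decomposition is applied to the difference of the measures as a charge on [G] alone: on
    the larger sigma-algebra the positive set need not lie in [G]. *)
Lemma hahn_subalgebra (mu nu : {finite_measure set T -> \bar R}) :
  sigma_subalgebra G ->
  exists2 P, G P & forall S, G S ->
    (S `<=` P -> nu S <= mu S) /\ (S `<=` ~` P -> mu S <= nu S).
Proof.
move=> [sG Gm]; pose S := g_sigma_algebraType G.
have mG (A : set S) : measurable A -> G A.
  by rewrite -[X in _ -> X A](sigma_algebra_id sG).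
pose n1 := charge_of_finite_measure mu.
pose n2 := copp (charge_of_finite_measure nu).
pose n0 : {charge set T -> \bar R} := cadd n1 n2.
pose n : set S -> \bar R := n0.
have nfin (A : set S) : measurable A -> n A \is a fin_num.
  by move=> /mG/Gm mA; exact: fin_num_measure.
have nadd : semi_sigma_additive n.
  move=> F mF tF mUF; apply: charge_semi_sigma_additive => //.
    by move=> i; apply: Gm; apply: mG; exact: mF.
  by apply: Gm; apply: mG.
have n_0 : n set0 = 0 by exact: charge0.
pose C := isCharge.Build _ S R n n_0 nfin nadd.
pose nu' : {charge set S -> \bar R} := HB.pack n C.
have [P [N [[mP posP] [mN negN] PN PN0]]] := Hahn_decomposition nu'.
have PCN : ~` P = N.
  apply/seteqP; split=> [x nPx|x Nx Px].
    by have : (P `|` N) x; [rewrite PN|case].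
  by have : (P `&` N) x by []; rewrite PN0.
exists P; first exact: mG.
move=> A GA; have mA : (measurable : set (set S)) A by exact: sub_sigma_algebra.
have fmu := fin_num_measure mu A (Gm _ GA).
have fnu := fin_num_measure nu A (Gm _ GA).
split=> AP.
  rewrite -(suber_ge0 _ fnu); exact: posP A mA AP.
have := negN A mA; rewrite -PCN => /(_ AP).
by move=> nA; rewrite -sube_le0; exact: nA.
Qed.

End indistinguishability.

(** * Couplings along one countably generated sub-sigma-algebra *)

Lemma exists_measure_add (R : realType) d (T : measurableType d)
    (m1 m2 : {measure set T -> \bar R}) :
  exists m : {measure set T -> \bar R}, forall A, m A = m1 A + m2 A.
Proof. by exists (measure_add m1 m2) => A; exact: measure_addE. Qed.

Section cell_coupling.
Context (R : realType) d (T : measurableType d).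
Context (mu nu : {finite_measure set T -> \bar R}).

(* Normalising by the larger of the two masses makes both marginals
   sub-measures and the smaller one is exhausted. *)
Lemma product_cell_coupling S : measurable S ->
  exists Q : {measure set (T * T)%type -> \bar R},
    [/\ forall B, measurable B -> Q (B `*` setT) <= mu (B `&` S),
        forall C, measurable C -> Q (setT `*` C) <= nu (C `&` S),
        nu S <= mu S -> Q setT = nu S &
        mu S <= nu S -> Q setT = mu S].
Proof.
move=> mS.
pose m := fine (mu S); pose n := fine (nu S).
have m0 : (0 <= m)%R by exact: fine_ge0.
have n0 : (0 <= n)%R by exact: fine_ge0.
have mE : mu S = m%:E by rewrite fineK// fin_num_measure.
have nE : nu S = n%:E by rewrite fineK// fin_num_measure.
have c0 : (0 <= (Num.max m n)^-1)%R by rewrite invr_ge0 le_max m0.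
pose Q : {measure set (T * T)%type -> \bar R} :=
  mscale (NngNum c0) (mrestr mu mS \x mrestr nu mS).
have QE B C : measurable B -> measurable C ->
    Q (B `*` C) = ((Num.max m n)^-1)%:E * (mu (B `&` S) * nu (C `&` S)).
  by move=> mB mC; rewrite /Q/= /mscale/= product_measure1E.
(* If both masses are 0, the inverse is 0 by convention and the bound still holds. *)
have cm : ((Num.max m n)^-1 * m <= 1)%R.
  have [->|M0] := eqVneq (Num.max m n) 0%R; first by rewrite invr0 mul0r.
  by rewrite mulrC ler_pdivrMr ?mul1r ?le_max ?lexx// lt_neqAle eq_sym M0 le_max m0.
have cn : ((Num.max m n)^-1 * n <= 1)%R.
  have [->|M0] := eqVneq (Num.max m n) 0%R; first by rewrite invr0 mul0r.
  by rewrite mulrC ler_pdivrMr ?mul1r ?le_max ?lexx ?orbT// lt_neqAle eq_sym M0 le_max m0.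
exists Q; split.
- move=> B mB; rewrite QE// setTI nE [mu _ * _]muleC muleA -EFinM.
  by rewrite gee_pMl// ?lee_fin// fin_num_measure//; exact: measurableI.
- move=> C mC; rewrite QE// setTI mE muleA -EFinM.
  by rewrite gee_pMl// ?lee_fin// fin_num_measure//; exact: measurableI.
- rewrite -setXTT QE// !setTI mE nE lee_fin => nm; rewrite max_l//.
  have [m00|mn0] := eqVneq m 0%R.
    by rewrite m00 mul0e mule0; congr EFin; apply/le_anti; rewrite n0 -m00 nm.
  by rewrite -!EFinM mulrA mulVf ?mul1r.
- rewrite -setXTT QE// !setTI mE nE lee_fin => mn; rewrite max_r//.
  have [n00|nn0] := eqVneq n 0%R.
    by rewrite n00 !mule0; congr EFin; apply/le_anti; rewrite m0 -n00 mn.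
  by rewrite -!EFinM mulrCA mulVf ?mulr1.
Qed.

Context (G : set (set T)) (sG : sigma_subalgebra G).
Context (A : (set T)^nat) (GA : forall n, G (A n)).
Context (P : set T) (GP : G P).
Hypothesis hahnP : forall S, G S ->
  (S `<=` P -> nu S <= mu S) /\ (S `<=` ~` P -> mu S <= nu S).

Let Gm B : G B -> measurable B. Proof. exact: sG.2. Qed.

(** Cells are refined by one set at a time: [S] is split along [A k], and both halves, again in [G],
    are coupled separately. The halves stay inside [P] or inside its complement if [S] does, and
    there the Hahn property tells which measure is the smaller one and is exhausted. *)
Lemma cell_coupling k S : G S ->
  exists Q : {measure set (T * T)%type -> \bar R},
    [/\ forall B, measurable B -> Q (B `*` setT) <= mu (B `&` S),
        forall C, measurable C -> Q (setT `*` C) <= nu (C `&` S),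
        forall i, (i < k)%N -> Q (A i `*` ~` A i) = 0 /\ Q (~` A i `*` A i) = 0,
        S `<=` P -> Q setT = nu S &
        S `<=` ~` P -> Q setT = mu S].
Proof.
elim: k S => [|k IH] S GS.
  have [Q [Q1 Q2 Qn Qm]] := product_cell_coupling (Gm GS).
  have [SP SnP] := hahnP GS.
  by exists Q; split=> // H; [exact/Qn/SP|exact/Qm/SnP].
have mS := Gm GS; have mA i := Gm (GA i).
have GCA := sigma_subalgebraC sG (GA k).
have [Q [Q1 Q2 Q0 Qn Qm]] := IH _ (sigma_subalgebraI sG GS (GA k)).
have [Q' [Q1' Q2' Q0' Qn' Qm']] := IH _ (sigma_subalgebraI sG GS GCA).
have split_meas (rho : {finite_measure set T -> \bar R}) B : measurable B ->
    rho (B `&` S) = rho (B `&` (S `&` A k)) + rho (B `&` (S `&` ~` A k)).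
  move=> mB; rewrite -measureU.
  - by rewrite -setIUr -setIUr setUCr setIT.
  - by do 2 apply: measurableI => //.
  - by do 2 apply: measurableI => //; exact: measurableC.
  - by rewrite -setIIr -setIIr setICr !setI0.
have [QQ QQE] := exists_measure_add Q Q'; exists QQ; split.
- by move=> B mB; rewrite QQE split_meas// leeD ?Q1 ?Q1'.
- by move=> B mB; rewrite QQE split_meas// leeD ?Q2 ?Q2'.
(* Both marginals of [Q] live inside [A k] and both marginals of [Q'] outside it, so neither charges
   pairs separated by [A k]; smaller indices come from the induction hypothesis. *)
- move=> i; rewrite ltnS leq_eqVlt => /predU1P[->|ik]; last first.
    by rewrite !QQE; have [-> ->] := Q0 i ik; have [-> ->] := Q0' i ik; rewrite !adde0.
  have mCA : measurable (~` A k) by exact: measurableC.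
  have le0 (rho : {measure set (T * T)%type -> \bar R}) B C : measurable B ->
      measurable C -> rho (B `*` setT) <= 0 \/ rho (setT `*` C) <= 0 ->
      rho (B `*` C) = 0.
    move=> mB mC H; apply/eqP; rewrite -measure_le0.
    by case: H; apply: le_trans; apply: le_measure;
      rewrite ?inE; (try exact: measurableX) => -[x y] [].
  have Q01 : Q (A k `*` ~` A k) = 0.
    apply: le0 => //; right; apply: (le_trans (Q2 _ mCA)).
    by rewrite setICA setICl setI0 measure0.
  have Q01' : Q' (A k `*` ~` A k) = 0.
    apply: le0 => //; left; apply: (le_trans (Q1' _ (mA k))).
    by rewrite setICA setICr setI0 measure0.
  have Q10 : Q (~` A k `*` A k) = 0.
    apply: le0 => //; left; apply: (le_trans (Q1 _ mCA)).
    by rewrite setICA setICl setI0 measure0.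
  have Q10' : Q' (~` A k `*` A k) = 0.
    apply: le0 => //; right; apply: (le_trans (Q2' _ (mA k))).
    by rewrite setICA setICr setI0 measure0.
  by rewrite !QQE Q01 Q01' Q10 Q10' adde0.
- move=> SP; rewrite QQE Qn ?Qn'; [|by apply: subIset; left|by apply: subIset; left].
  by have := split_meas nu setT measurableT; rewrite !setTI.
- move=> SP; rewrite QQE Qm ?Qm'; [|by apply: subIset; left|by apply: subIset; left].
  by have := split_meas mu setT measurableT; rewrite !setTI.
Qed.

(** The couplings of the cell [P] and of its complement are added. All clauses are bounds or null
    conditions on measurable rectangles, a form that passes to the limit in [k]. *)
Lemma finite_level_coupling k :
  exists Q : {measure set (T * T)%type -> \bar R},
    [/\ forall B, measurable B -> Q (B `*` setT) <= mu B,
        forall C, measurable C -> Q (setT `*` C) <= nu C,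
        forall i, (i < k)%N -> Q (A i `*` ~` A i) = 0 /\ Q (~` A i `*` A i) = 0,
        nu P <= Q (setT `*` P) &
        mu (~` P) <= Q (~` P `*` setT)].
Proof.
have mP := Gm GP; have mCP : measurable (~` P) by exact: measurableC.
have [Q [Q1 Q2 Q0 Qn _]] := cell_coupling k GP.
have [Q' [Q1' Q2' Q0' _ Qm]] := cell_coupling k (sigma_subalgebraC sG GP).
have split_meas (rho : {finite_measure set T -> \bar R}) B : measurable B ->
    rho B = rho (B `&` P) + rho (B `&` ~` P).
  move=> mB; rewrite -measureU.
  - by rewrite -setIUr setUCr setIT.
  - exact: measurableI.
  - exact: measurableI.
  - by rewrite -setIIr setICr setI0.
have [QQ QQE] := exists_measure_add Q Q'; exists QQ; split.
- by move=> B mB; rewrite QQE (split_meas mu)// leeD ?Q1 ?Q1'.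
- by move=> B mB; rewrite QQE (split_meas nu)// leeD ?Q2 ?Q2'.
- by move=> i ik; rewrite !QQE; have [-> ->] := Q0 i ik; have [-> ->] := Q0' i ik; rewrite !adde0.
- rewrite QQE -Qn// (_ : setT = setT `*` P `|` setT `*` ~` P); last first.
    apply/seteqP; split=> [[x y] _|//].
    by have [Py|nPy] := pselect (P y); [left|right].
  rewrite measureU; [|exact: measurableX|exact: measurableX|]; last first.
    by rewrite -setXI setICr setX0.
  rewrite leeD// (le_trans (Q2 _ _))// setICl measure0.
  exact: measure_ge0.
- rewrite QQE -Qm// (_ : setT = P `*` setT `|` ~` P `*` setT); last first.
    apply/seteqP; split=> [[x y] _|//].
    by have [Px|nPx] := pselect (P x); [left|right].
  rewrite measureU; [|exact: measurableX|exact: measurableX|]; last first.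
    by rewrite -setXI setICr set0X.
  rewrite leeD// (le_trans (Q1' _ _))// setICr measure0.
  exact: measure_ge0.
Qed.

End cell_coupling.

Section subalgebra_coupling.
Context (R : realType) d (T : measurableType d).
Hypothesis sbT : standard_borel R T.

(** The finite-level couplings have a finitely additive limit. Pairs separated by [A n] are null
    from level n+1 on, hence in the limit, and the complement of [indist G] is a countable union of
    such sets of pairs. Tight marginals make the limit extend to a measure, and the other bounds
    carry over since they concern rectangles. *)
Lemma subalgebra_coupling (mu nu : {finite_measure set T -> \bar R})
    (G : set (set T)) :
  sigma_subalgebra G -> countably_generated G ->
  exists (Q : {measure set (T * T)%type -> \bar R}) (P : set T),
    [/\ G P /\ Q (~` indist G) = 0,
        forall B, measurable B -> Q (B `*` setT) <= mu B,
        forall C, measurable C -> Q (setT `*` C) <= nu C,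
        nu P <= Q (setT `*` P) &
        mu (~` P) <= Q (~` P `*` setT)].
Proof.
move=> sG cG; have [A GA EA] := indist_countably_generated sG.1 cG.
have [P GP hP] := hahn_subalgebra mu nu sG.
have /choice[Q QP] := finite_level_coupling sG GA GP hP.
have mP : measurable P by exact: sG.2.
have mA n : measurable (A n) by exact: sG.2.
have [|q qP] := @exists_ultralimit_content R _ _ Q (fine (mu setT)).
  move=> k; rewrite fineK ?fin_num_measure// -setXTT.
  by have [+ _ _ _ _] := QP k; apply.
have q1 B : measurable B -> q (B `*` setT) <= mu B.
  move=> mB; have /(_ (measurableX mB measurableT))[+ _] := qP (B `*` setT) (mu B).
  by apply; apply: nearW => k; have [+ _ _ _ _] := QP k; apply.
have q2 C : measurable C -> q (setT `*` C) <= nu C.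
  move=> mC; have /(_ (measurableX measurableT mC))[+ _] := qP (setT `*` C) (nu C).
  by apply; apply: nearW => k; have [_ + _ _ _] := QP k; apply.
have [S SE] := rectangle_content_extension
  (tight_content_subadditive q1 q2 sbT sbT).
have rX B C : measurable B -> measurable C -> rectangle (B `*` C : set (T * T)).
  by move=> mB mC; exists B => //; exists C.
exists S, P; split.
- split=> //; rewrite EA; apply/eqP; rewrite -measure_le0.
  have mAA n : measurable (A n `*` ~` A n `|` ~` A n `*` A n).
    by apply: measurableU; apply: measurableX => //; exact: measurableC.
  rewrite (le_trans (generalized_Boole_inequality _ _ _))//.
    exact: bigcup_measurable.
  rewrite eseries0// => n _ _.
  have mCA : measurable (~` A n) by exact: measurableC.
  have -> : S (A n `*` ~` A n `|` ~` A n `*` A n) =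
      q (A n `*` ~` A n) + q (~` A n `*` A n).
    rewrite -!SE; [|exact: rX|exact: rX].
    apply: measureU; [exact: measurableX|exact: measurableX|].
    by rewrite -setXI setICr set0X.
  have Q0 : \forall k \near \oo, Q k (A n `*` ~` A n) = 0 /\ Q k (~` A n `*` A n) = 0.
    by exists n.+1 => // k /= nk; have [_ _ + _ _] := QP k; apply.
  apply/eqP; rewrite -[_ == _]andbT padde_eq0//.
  have le0 W : measurable W -> (\forall k \near \oo, Q k W = 0) -> q W = 0.
    move=> mW QW; apply/eqP; rewrite -measure_le0; have [+ _] := qP W 0 mW.
    by apply; apply: filterS QW => k ->.
  apply/andP; split=> //; apply/andP; split.
    apply/eqP/le0; first exact: measurableX.
    by apply: filterS Q0 => k [].
  apply/eqP/le0; first exact: measurableX.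
  by apply: filterS Q0 => k [].
- by move=> B mB; rewrite SE ?q1//; exact: rX.
- by move=> C mC; rewrite SE ?q2//; exact: rX.
- rewrite SE; last exact: rX.
  have /(_ (measurableX measurableT mP))[_ +] := qP (setT `*` P) (nu P).
  by apply; apply: nearW => k; have [_ _ _ + _] := QP k; apply.
- have mCP : measurable (~` P) by exact: measurableC.
  rewrite SE; last exact: rX.
  have /(_ (measurableX mCP measurableT))[_ +] := qP (~` P `*` setT) (mu (~` P)).
  by apply; apply: nearW => k; have [_ _ _ _ +] := QP k; apply.
Qed.

Lemma finite_measure_sub (mu : {finite_measure set T -> \bar R})
    (m : {measure set T -> \bar R}) :
  (forall B, measurable B -> m B <= mu B) ->
  exists mu' : {finite_measure set T -> \bar R},
    forall B, measurable B -> mu B = mu' B + m B.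
Proof.
move=> mmu.
have fm : fin_num_fun m.
  move=> B mB; rewrite ge0_fin_numE// (le_lt_trans (mmu _ mB))//.
  by rewrite -ge0_fin_numE// fin_num_measure.
pose m0 : set T -> \bar R := fun B => m B.
pose C := isCharge.Build _ T R m0 (measure0 m) fm
  (@measure_semi_sigma_additive _ _ _ m).
pose m' : {charge set T -> \bar R} := HB.pack m0 C.
pose n : {charge set T -> \bar R} :=
  cadd (charge_of_finite_measure mu) (copp m').
(* The absolute value changes nothing on measurable sets and makes [r] nonnegative on all sets, as a
   measure demands. *)
pose r : set T -> \bar R := fun B => `|n B|.
have rE B : measurable B -> r B = mu B - m B.
  move=> mB; rewrite /r gee0_abs//.
  by rewrite [n B]/(mu B - m B) suber_ge0 ?mmu// fm.
have r0 : r set0 = 0 by rewrite rE// !measure0 sube0.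
have radd : semi_sigma_additive r.
  move=> F mF' tF mUF; rewrite rE//.
  rewrite (_ : (fun _ => _) = (fun k => \sum_(0 <= i < k) n (F i))).
    exact: (charge_semi_sigma_additive (s := n)).
  by apply/funext => k; apply: eq_bigr => i _; rewrite rE.
pose M := isMeasure.Build _ T R r r0 (fun B => abse_ge0 _) radd.
pose rM : {measure set T -> \bar R} := HB.pack r M.
have rf : fin_num_fun rM.
  by move=> B mB; rewrite /rM/= rE// fin_numB fin_num_measure//= fm.
pose rF := Measure_isFinite.Build _ T R rM rf.
pose mu' : {finite_measure set T -> \bar R} := HB.pack r M rF.
by exists mu' => B mB; rewrite /mu'/= rE// subeK// fm.
Qed.

End subalgebra_coupling.

(** * Decreasing sequences of sub-sigma-algebras *)

Section sigma_subalgebra_bigcap.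
Context (R : realType) d (T : measurableType d).

Lemma sigma_subalgebra_bigcup (G : set (set T)) (A : (set T)^nat) :
  sigma_subalgebra G -> (forall n, G (A n)) -> G (\bigcup_n A n).
Proof. by move=> [[_ _ +] _] GA; apply. Qed.

Lemma sigma_subalgebra_bigcap (G : set (set T)) (A : (set T)^nat) :
  sigma_subalgebra G -> (forall n, G (A n)) -> G (\bigcap_n A n).
Proof.
move=> sG GA; rewrite -[\bigcap_n A n]setCK; apply: sigma_subalgebraC => //.
rewrite setC_bigcap; apply: sigma_subalgebra_bigcup => // n.
exact: sigma_subalgebraC.
Qed.

(** The class of [x] is the countable intersection, over the separating sequence, of [A n] or its
    complement, whichever contains [x]. *)
Lemma indist_section (G : set (set T)) (x : T) :
  sigma_subalgebra G -> countably_generated G ->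
  G [set y | indist G (x, y)].
Proof.
move=> sG cG; have [A GA EA] := indist_countably_generated sG.1 cG.
rewrite (_ : [set y | _] = \bigcap_n [set y | A n x <-> A n y]); last first.
  apply/seteqP; split=> [y xy n _|y /= xy]; first exact: (xy _ (GA n)).
  apply: contrapT => nxy; have : (~` indist G) (x, y) by [].
  rewrite EA => -[n _ /= An]; have [xyn yxn] := xy n I.
  by case: An => -[Ax Ay]; [exact/Ay/xyn|exact/Ax/yxn].
apply: sigma_subalgebra_bigcap => // n.
have [Ax|nAx] := pselect (A n x).
  rewrite (_ : [set y | _] = A n)//.
  by apply/seteqP; split=> [y /= [/(_ Ax)]//|y /= Ay].
rewrite (_ : [set y | _] = ~` A n); first exact: sigma_subalgebraC.
by apply/seteqP; split=> [y /= [_ yx] /yx//|y /= nAy]; split.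
Qed.

Context (Gn : nat -> set (set T)).
Hypothesis sGn : forall n, sigma_subalgebra (Gn n).
Hypothesis GnS : forall n, Gn n.+1 `<=` Gn n.

Lemma decreasing_subalgebras m n : (m <= n)%N -> Gn n `<=` Gn m.
Proof.
move=> /subnK <-; elim: (n - m)%N => [//|k IH].
by rewrite addSn; apply: subset_trans IH; exact: GnS.
Qed.

Hypothesis cGn : forall n, countably_generated (Gn n).

(* The union over [n] of the [Gn n]-classes of [x] lies in every [Gn m], since
   the terms of index below [m] may be dropped from this increasing union. *)
Lemma indist_bigcap :
  indist (\bigcap_n Gn n) = \bigcup_n indist (Gn n).
Proof.
apply/seteqP; split=> [[x y] xy|[x y] [n _ xy] A GA]; last exact/xy/GA.
pose D n := [set z | indist (Gn n) (x, z)].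
have DS m n : (m <= n)%N -> D m `<=` D n.
  by move=> mn z xz A /(decreasing_subalgebras mn); exact: xz.
(* This union contains [x], so it contains every [y] that no set of the intersection separates from
   [x]; such a [y] then lies in some class [D n]. *)
suff GD : (\bigcap_n Gn n) (\bigcup_n D n).
  have [/= + _] := xy _ GD; case; first by exists 0%N.
  by move=> n _ Dny; exists n.
move=> m _.
rewrite (_ : \bigcup_n D n = \bigcup_n D (n + m)%N).
  apply: (sigma_subalgebra_bigcup (sGn m)) => n; apply: (decreasing_subalgebras (leq_addl n m)).
  exact: indist_section.
apply/seteqP; split=> z [n _ Dz]; last by exists (n + m)%N.
by exists n => //; apply: DS Dz; exact: leq_addr.
Qed.

(** The upper limit does not change when the indices below m are dropped, and the remaining sets all
    lie in [Gn m]. *)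
Lemma bigcap_lim_sup_set (P : (set T)^nat) :
  (forall n, Gn n (P n)) -> (\bigcap_n Gn n) (lim_sup_set P).
Proof.
move=> GP m _.
rewrite (_ : lim_sup_set P = \bigcap_n \bigcup_j P (n + m + j)%N).
  apply: sigma_subalgebra_bigcap => // n; apply: (sigma_subalgebra_bigcup (sGn m)) => j.
  by apply: decreasing_subalgebras (GP _); rewrite -addnA addnCA leq_addr.
apply/seteqP; split=> x Px n _.
  have [j /= nj Pj] := Px (n + m)%N I.
  by exists (j - (n + m))%N => //; rewrite subnKC.
by have [j _ Pj] := Px n I; exists (n + m + j)%N => //=; rewrite -addnA leq_addr.
Qed.

End sigma_subalgebra_bigcap.

Lemma exists_marginals (R : realType) d (T : measurableType d)
    (Q : {measure set (T * T)%type -> \bar R}) :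
  exists Q1 Q2 : {measure set T -> \bar R},
    (forall B, Q1 B = Q (B `*` setT)) /\ (forall C, Q2 C = Q (setT `*` C)).
Proof.
have mf := @measurable_fst _ _ T T; have ms := @measurable_snd _ _ T T.
unshelve eexists (pushforward Q fst); first exact: mf.
unshelve eexists (pushforward Q snd); first exact: ms.
by split=> B; rewrite /= /pushforward ?setXT ?setTX.
Qed.

Lemma measure0_bigcup (R : realType) d (T : measurableType d)
    (mu : {measure set T -> \bar R}) (A : (set T)^nat) :
  (forall n, measurable (A n)) -> (forall n, mu (A n) = 0) ->
  mu (\bigcup_n A n) = 0.
Proof.
move=> mA A0; apply/eqP; rewrite -measure_le0.
rewrite (le_trans (generalized_Boole_inequality _ _ _))//.
  exact: bigcup_measurable.
by rewrite eseries0.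
Qed.

Section decreasing_coupling.
Context (R : realType) d (T : measurableType d).
Hypothesis sbT : standard_borel R T.
Context (Gn : nat -> set (set T)).
Hypothesis sGn : forall n, sigma_subalgebra (Gn n).
Hypothesis GnS : forall n, Gn n.+1 `<=` Gn n.
Hypothesis cGn : forall n, countably_generated (Gn n).

(** The parts of the two measures that are not coupled yet. *)
Let state : Type :=
  {finite_measure set T -> \bar R} * {finite_measure set T -> \bar R}.

(** The tuple [r] holds the next remainders, the measure coupled at this stage and the Hahn set.
    Since all of the second measure is coupled on that set and all of the first off it, the
    remainders are carried by the set and by its complement. A single tuple lets the step be
    iterated by choice. *)
Lemma coupling_step (G : set (set T)) (s : state) :
  sigma_subalgebra G -> countably_generated G ->
  exists r : state * {measure set (T * T)%type -> \bar R} * set T,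
    [/\ G r.2 /\ r.1.2 (~` indist G) = 0,
        forall B, measurable B -> s.1 B = r.1.1.1 B + r.1.2 (B `*` setT),
        forall C, measurable C -> s.2 C = r.1.1.2 C + r.1.2 (setT `*` C),
        r.1.1.1 (~` r.2) = 0 & r.1.1.2 r.2 = 0].
Proof.
case: s => mu nu sG cG /=.
have [Q [P [[GP QE] Q1 Q2 nuP muP]]] := subalgebra_coupling sbT mu nu sG cG.
have [m1 [m2 [m1E m2E]]] := exists_marginals Q.
have [|mu' mu'E] := @finite_measure_sub _ _ _ mu m1.
  by move=> B mB; rewrite m1E Q1.
have [|nu' nu'E] := @finite_measure_sub _ _ _ nu m2.
  by move=> C mC; rewrite m2E Q2.
have mP : measurable P by exact: sG.2.
have rest0 (rho rho' : {finite_measure set T -> \bar R})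
    (m : {measure set T -> \bar R}) B : measurable B ->
    rho B = rho' B + m B -> rho B <= m B -> rho' B = 0.
  move=> mB rhoE; have : rho' B + m B \is a fin_num.
    by rewrite -rhoE; exact: fin_num_measure.
  rewrite fin_numD => /andP[_ mfin]; rewrite rhoE -leeBrDr// subee// => rho'0.
  by apply/eqP; rewrite -measure_le0.
exists (mu', nu', Q, P); split => //=.
- by move=> B mB; rewrite mu'E// m1E.
- by move=> C mC; rewrite nu'E// m2E.
- have mCP : measurable (~` P) by exact: measurableC.
  by apply: (rest0 mu mu' m1 _ mCP (mu'E _ mCP)); rewrite m1E.
- by apply: (rest0 nu nu' m2 _ mP (nu'E _ mP)); rewrite m2E.
Qed.
(** The couplings of all stages are summed, and [mu'] and [nu'] are what the sum leaves over. They
    lie below the remainders of every stage, so [mu'] vanishes off each [P n] and [nu'] on each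
    [P n]. The upper limit of the [P n] inherits both properties by countable subadditivity and,
    unlike a single [P n], is sure to lie in every [Gn m]. *)
Lemma decreasing_coupling (mu nu : {finite_measure set T -> \bar R}) :
  let G := \bigcap_n Gn n in
  exists (Q : {measure set (T * T)%type -> \bar R})
      (mu' nu' : {finite_measure set T -> \bar R}) (A : set T),
    [/\ G A /\ Q (~` indist G) = 0,
        forall B, measurable B -> mu B = mu' B + Q (B `*` setT),
        forall C, measurable C -> nu C = nu' C + Q (setT `*` C),
        mu' (~` A) = 0 & nu' A = 0].
Proof.
move=> G.
have /choice[F FP] : forall ns : nat * state, exists r, _ :=
  fun ns => coupling_step ns.2 (sGn ns.1) (cGn ns.1).
pose s := fix s n : state := if n is n'.+1 then (F (n', s n')).1.1 else (mu, nu).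
pose q n := (F (n, s n)).1.2; pose P n := (F (n, s n)).2.
have GP n : Gn n (P n) by have [[]] := FP (n, s n).
have mP n : measurable (P n) by exact: (sGn n).2.
have sE1 n B : measurable B ->
    mu B = (s n).1 B + \sum_(0 <= i < n) q i (B `*` setT).
  move=> mB; elim: n => [|n ->]; first by rewrite big_geq// adde0.
  have [_ H _ _ _] := FP (n, s n).
  by rewrite big_nat_recr//= H// -addeA [q n _ + _]addeC.
have sE2 n C : measurable C ->
    nu C = (s n).2 C + \sum_(0 <= i < n) q i (setT `*` C).
  move=> mC; elim: n => [|n ->]; first by rewrite big_geq// adde0.
  have [_ _ H _ _] := FP (n, s n).
  by rewrite big_nat_recr//= H// -addeA [q n _ + _]addeC.
pose Q : {measure set (T * T)%type -> \bar R} := mseries q 0.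
have QE W : Q W = \sum_(0 <= k <oo) q k W by [].
have [m1 [m2 [m1E m2E]]] := exists_marginals Q.
have lim_le W b : (forall n, \sum_(0 <= i < n) q i W <= b) -> Q W <= b.
  move=> H; rewrite QE; apply: lime_le; first exact: is_cvg_nneseries.
  exact: nearW.
have [|mu' mu'E] := @finite_measure_sub _ _ _ mu m1.
  move=> B mB; rewrite m1E; apply: lim_le => n.
  by rewrite (sE1 n B mB) leeDr.
have [|nu' nu'E] := @finite_measure_sub _ _ _ nu m2.
  move=> C mC; rewrite m2E; apply: lim_le => n.
  by rewrite (sE2 n C mC) leeDr.
have rest_le (rho rho' sn : {finite_measure set T -> \bar R})
    (m : {measure set T -> \bar R}) B (x : \bar R) : measurable B ->
    rho B = rho' B + m B -> rho B = sn B + x -> x <= m B -> rho' B <= sn B.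
  move=> mB E1 E2 xm.
  have : rho' B + m B \is a fin_num by rewrite -E1; exact: fin_num_measure.
  rewrite fin_numD => /andP[_ mfin].
  by rewrite -(leeD2rE _ _ mfin) -E1 E2 leeD2l.
have sum_le n W : \sum_(0 <= i < n) q i W <= Q W.
  by rewrite QE; apply: nneseries_lim_ge.
have mu'_le n B : measurable B -> mu' B <= (s n).1 B.
  move=> mB; apply: (rest_le _ _ _ _ _ _ mB (mu'E _ mB) (sE1 n _ mB)).
  by rewrite m1E.
have nu'_le n B : measurable B -> nu' B <= (s n).2 B.
  move=> mB; apply: (rest_le _ _ _ _ _ _ mB (nu'E _ mB) (sE2 n _ mB)).
  by rewrite m2E.
have mCP n : measurable (~` P n) by exact: measurableC.
(* The remainder known to vanish off [P n] is the one left after stage n, that is [(s n.+1).1]. *)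
have mu'0 n : mu' (~` P n) = 0.
  apply/eqP; rewrite -measure_le0 (le_trans (mu'_le n.+1 _ (mCP n)))//.
  by have [_ _ _ + _] := FP (n, s n) => /= ->.
have nu'0 n : nu' (P n) = 0.
  apply/eqP; rewrite -measure_le0 (le_trans (nu'_le n.+1 _ (mP n)))//.
  by have [_ _ _ _] := FP (n, s n) => /= ->.
have GA := bigcap_lim_sup_set sGn GnS GP.
have mA : measurable (lim_sup_set P) by apply: (sGn 0).2; exact: GA.
exists Q, mu', nu', (lim_sup_set P); split.
- split=> //; rewrite QE eseries0// => n _ _.
  have mE k : measurable (indist (Gn k)) by exact: measurable_indist.
  have mCE : measurable (~` indist G).
    rewrite /G (indist_bigcap sGn GnS cGn); apply: measurableC.
    exact: bigcup_measurable.
  (* The measure [q n] does not charge the complement of [indist (Gn n)], and this relation is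
     contained in [indist G] because [G] is contained in [Gn n]. *)
  have [[_ qE] _ _ _ _] := FP (n, s n).
  apply: subset_measure0 mCE (measurableC (mE n)) _ qE.
  by apply: subsetC => w Ew B GB; apply: Ew; exact: GB.
- by move=> B mB; rewrite mu'E// m1E.
- by move=> C mC; rewrite nu'E// m2E.
- rewrite /lim_sup_set setC_bigcap; apply: measure0_bigcup => n.
    by apply: measurableC; apply: bigcup_measurable => k _; exact: mP.
  apply: subset_measure0 (mCP n) _ (mu'0 n).
    by apply: measurableC; apply: bigcup_measurable => k _; exact: mP.
  by apply: subsetC => x Px; exists n => /=.
- apply: subset_measure0 mA (bigcup_measurable (fun k _ => mP k)) _
    (measure0_bigcup mP nu'0).
  by move=> x /(_ 0%N I)[k _ Pk]; exists k.
Qed.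

End decreasing_coupling.

(** * Strong duality *)

Section duality.
Context (R : realType) d (T : measurableType d).
Context (G : set (set T)) (sG : sigma_subalgebra G).
Hypothesis mE : measurable (indist G).

(** A pair in [indist G] has both coordinates in [A] or neither, so the two strips over [A] differ
    only outside the relation. Weak duality rests on this. *)
Lemma split_indist (Q : {measure set (T * T)%type -> \bar R}) A : G A ->
  Q (A `*` setT) <= Q (setT `*` A) + Q (~` indist G) /\
  Q (setT `*` A) <= Q (A `*` setT) + Q (~` indist G).
Proof.
move=> GA; have mA : measurable A by exact: sG.2.
have mCE : measurable (~` indist G) by exact: measurableC.
have mX := measurableX mA (@measurableT _ T).
have mX' := measurableX (@measurableT _ T) mA.
split.
- apply: le_trans (measureU2 Q mX' mCE); apply: le_measure; rewrite ?inE//.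
    exact: measurableU.
  move=> [x y] [/= Ax _]; have [Exy|] := pselect (indist G (x, y)); last by right.
  by left; split => //=; exact/(Exy A GA).1.
- apply: le_trans (measureU2 Q mX mCE); apply: le_measure; rewrite ?inE//.
    exact: measurableU.
  move=> [x y] [/= _ Ay]; have [Exy|] := pselect (indist G (x, y)); last by right.
  by left; split => //=; exact/(Exy A GA).2.
Qed.

Lemma weak_duality (P P' : probability T R) (Q : probability (T * T)%type R) A :
  couplings P P' Q -> G A -> `|P A - P' A| <= 1 - Q (indist G).
Proof.
move=> PQ GA; have mA : measurable A by exact: sG.2.
have QP : Q (A `*` setT) = P A by rewrite setXT; exact: (PQ A mA).1.
have QP' : Q (setT `*` A) = P' A by rewrite setTX; exact: (PQ A mA).2.
have : P' A <= P A + (1 - Q (indist G)).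
  by rewrite -QP -QP' -probability_setC//; exact: (split_indist Q GA).2.
have : P A <= P' A + (1 - Q (indist G)).
  by rewrite -QP -QP' -probability_setC//; exact: (split_indist Q GA).1.
have fP := fin_num_measure P A mA; have fP' := fin_num_measure P' A mA.
have fQ := fin_num_measure Q _ mE.
rewrite -(fineK fP) -(fineK fP') -(fineK fQ) -!EFinB -!EFinD /= !lee_fin ler_norml => H1 H2.
by rewrite lerNl opprB !lerBlDl H1 H2.
Qed.

End duality.

(* The uncoupled remainders [mu'] and [nu'] have the same mass, so the rescaled
   product completes [S]; when that mass is 0 the junk value [0^-1 = 0] is
   harmless. *)
Lemma complete_coupling (R : realType) d (T : measurableType d)
    (P P' : probability T R) (S : {measure set (T * T)%type -> \bar R})
    (mu' nu' : {finite_measure set T -> \bar R}) :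
  (forall B, measurable B -> P B = mu' B + S (B `*` setT)) ->
  (forall C, measurable C -> P' C = nu' C + S (setT `*` C)) ->
  exists2 Q : probability (T * T)%type R, couplings P P' Q &
    forall W, measurable W -> Q W <= S W + mu' setT.
Proof.
move=> PE P'E.
have S1 : P setT = mu' setT + S setT by rewrite PE// setXTT.
have S2 : P' setT = nu' setT + S setT by rewrite P'E// setXTT.
have Sfin : S setT \is a fin_num.
  have : mu' setT + S setT \is a fin_num by rewrite -S1; exact: fin_num_measure.
  by rewrite fin_numD => /andP[].
have mE : mu' setT = (fine (mu' setT))%:E by rewrite fineK// fin_num_measure.
have munu : nu' setT = mu' setT.
  rewrite -[LHS](addeK _ Sfin) -[RHS](addeK _ Sfin) -S1 -S2.
  by rewrite !probability_setT.
set m := fine (mu' setT) in mE.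
have c0 : (0 <= m^-1)%R by rewrite invr_ge0 fine_ge0.
pose N : {measure set (T * T)%type -> \bar R} := mscale (NngNum c0) (mu' \x nu').
have NE B C : measurable B -> measurable C ->
    N (B `*` C) = (m^-1)%:E * (mu' B * nu' C).
  by move=> mB mC; rewrite /N/= /mscale/= product_measure1E.
have cancel (rho : {finite_measure set T -> \bar R}) B : measurable B ->
    rho setT = m%:E -> (m^-1)%:E * (m%:E * rho B) = rho B.
  move=> mB rhoE; have [m0|m0] := eqVneq m 0%R.
    rewrite m0 mul0e mule0; apply/esym/eqP; rewrite -measure_le0.
    apply: (@le_trans _ _ (rho setT)); last by rewrite rhoE m0.
    by apply: le_measure; rewrite ?inE.
  by rewrite muleA -EFinM mulVf// mul1e.
have N1 B : measurable B -> N (B `*` setT) = mu' B.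
  by move=> mB; rewrite NE// munu mE muleC [mu' B * _]muleC muleC cancel.
have N2 C : measurable C -> N (setT `*` C) = nu' C.
  by move=> mC; rewrite NE// mE cancel// munu mE.
have [Q0 Q0E] := exists_measure_add S N.
have Q0T : Q0 setT = 1.
  by rewrite -setXTT Q0E N1// addeC -PE// probability_setT.
pose q : set (T * T) -> \bar R := fun W => Q0 W.
pose M := isMeasure.Build _ _ R q (measure0 Q0) (measure_ge0 Q0)
  (@measure_semi_sigma_additive _ _ _ Q0).
pose qM : {measure set (T * T)%type -> \bar R} := HB.pack q M.
pose Pr := Measure_isProbability.Build _ _ R qM Q0T.
pose Q : probability (T * T)%type R := HB.pack q M Pr.
exists Q.
- move=> A mA; rewrite /pushforward -setXT -setTX /Q/= /q !Q0E N1// N2//.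
  by rewrite PE// P'E// !(addeC (S _)).
- move=> W mW; rewrite /Q/= /q Q0E leeD2l//.
  rewrite (@le_trans _ _ (N setT))//; first by apply: le_measure; rewrite ?inE.
  by rewrite -setXTT N1.
Qed.

Theorem corollary3p23 (R : realType) (d : measure_display)
    (Omega : measurableType d) (HOmega : standard_borel R Omega)
    (G : set (set Omega)) (HG : sigma_subalgebra G)
    (Gn : nat -> set (set Omega))
    (HGn : forall n : nat, sigma_subalgebra (Gn n))
    (HGncg : forall n : nat, countably_generated (Gn n))
    (HGnS : forall n : nat, Gn n.+1 `<=` Gn n)
    (HGE : G = \bigcap_n Gn n) :
  strongly_dualizable R G.
Proof.
have mE : measurable (indist G).
  rewrite HGE (indist_bigcap HGn HGnS HGncg).
  by apply: bigcup_measurable => n _; exact: measurable_indist.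
split=> //.
  split=> [x A _|x y xy A GA|x y z xy yz A GA]; first by [].
    by have [? ?] := xy A GA.
  by have [? ?] := xy A GA; have [? ?] := yz A GA; split; auto.
move=> P P' V C.
have [S [mu' [nu' [A [[GA SE] PE P'E muA nuA]]]]] :=
  decreasing_coupling HOmega HGn HGnS HGncg P P'.
rewrite -HGE in GA SE.
have mA : measurable A by exact: HG.2.
have [Q PQ QS] := complete_coupling PE P'E.
(* Since [S] is carried by [indist G], both strips over [A] have the same mass. The coupled parts
   therefore cancel in [P A - P' A], which leaves the mass of the remainder [mu']. *)
have S0 : S (A `*` setT) = S (setT `*` A).
  have [S12 S21] := split_indist HG mE S GA.
  by apply/le_anti; rewrite SE !adde0 in S12 S21; rewrite S12 S21.
have PA : P A - P' A = mu' setT.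
  have mCA : measurable (~` A) by exact: measurableC.
  have -> : mu' setT = mu' A + mu' (~` A) by rewrite -measureU ?setICr// setUv.
  have Sfin : S (setT `*` A) \is a fin_num.
    have : nu' A + S (setT `*` A) \is a fin_num.
      by rewrite -P'E//; exact: fin_num_measure.
    by rewrite fin_numD => /andP[].
  by rewrite PE// P'E// nuA muA add0e adde0 S0 addeK.
have VA : V `|P A - P' A| by exists A.
(* Outside the relation the completed coupling has only mass added to [S], hence at most [mu' setT],
   which equals [P A - P' A]. Weak duality gives the reverse inequality, so [A] and [Q] attain the
   two extrema. *)
have QE : 1 - Q (indist G) <= `|P A - P' A|.
  rewrite PA gee0_abs// -probability_setC//.
  by rewrite (le_trans (QS _ (measurableC mE)))// SE add0e.
have VC v c : V v -> C c -> v <= c.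
  by move=> [B GB <-] [Q' PQ' <-]; exact: weak_duality.
have CQ : C (1 - Q (indist G)) by exists Q.
have QA : 1 - Q (indist G) = `|P A - P' A| by apply/le_anti; rewrite QE VC.
have supV : ereal_sup V = `|P A - P' A|.
  apply/le_anti; rewrite ereal_sup_ubound// andbT.
  by apply: ge_ereal_sup => v Vv; rewrite -QA VC.
have infC : ereal_inf C = `|P A - P' A|.
  apply/le_anti; rewrite -{1}QA ereal_inf_lbound//=.
  by apply: le_ereal_inf_tmp => c Cc; rewrite VC.
by split; rewrite ?supV ?infC// -QA.
Qed.
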